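(* Let $(G,\odot)$ be a binary group and let $(G,[\ ])=\mathrm{der}(G,\odot)$ be the ternary group derived from it, i.e. $[xyz]=x\odot y\odot z$ for all $x,y,z\in G$. Let $V$ be a vector space over a field $\mathbb{K}$. Then there is a one-to-one correspondence between representations of the group $(G,\odot)$ in $V$ and left representations of the ternary group $(G,[\ ])$ in $V$.
   Context: A ternary semigroup $(G,[\ ])$ is a non-empty set $G$ with a map $[\ ]:G\times G\times G\to G$ such that $[[xyz]uv]=[x[yzu]v]=[xy[zuv]]$ for all $x,y,z,u,v\in G$. It is a ternary group if for all $a,b,c\in G$ there are $x,y,z\in G$ with $[xab]=[ayb]=[abz]=c$ (such $x,y,z$ are then unique). In a ternary group the skew element $\overline{x}$ of $x$ is the unique solution $z$ of $[xxz]=x$. A left representation of a ternary group $(G,[\ ])$ in $V$ is a map $\Pi^L:G\times G\to\operatorname{End}V$ (linear endomorphisms of $V$) such that $\Pi^L(x_1,x_2)\circ\Pi^L(x_3,x_4)=\Pi^L([x_1x_2x_3],x_4)$ for all $x_1,x_2,x_3,x_4\in G$ and $\Pi^L(x,\overline{x})=\mathrm{id}_V$ for all $x\in G$. A representation of a binary group in $V$ is a group homomorphism into $GL(V)$. *)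

(* Defs.v *)
From HB Require Import structures.
From mathcomp Require Import all_boot all_algebra.
From mathcomp Require Import boolp.

Set Implicit Arguments.
Unset Strict Implicit.
Unset Printing Implicit Defensive.

Import GRing.Theory.
Local Open Scope group_scope.

Reserved Notation "[t x y z ]"
  (at level 0, x at level 8, y at level 8, z at level 8,
   format "[t  x  y  z ]").

HB.mixin Record isTernarySemigroup G := {
  termul : G -> G -> G -> G;
  tsg_nonempty : inhabited G;
  termulAl : forall x y z u v : G,
    termul (termul x y z) u v = termul x (termul y z u) v;
  termulAr : forall x y z u v : G,
    termul x (termul y z u) v = termul x y (termul z u v)
}.

#[short(type="ternarySemigroupType")]
HB.structure Definition TernarySemigroup := {G of isTernarySemigroup G}.

Notation "[t x y z ]" := (termul x y z).

HB.mixin Record TernarySemigroup_isTernaryGroup G of TernarySemigroup G := {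
  tsolve_l : forall a b c : G, exists x : G, [t x a b] = c;
  tsolve_m : forall a b c : G, exists y : G, [t a y b] = c;
  tsolve_r : forall a b c : G, exists z : G, [t a b z] = c
}.

#[short(type="ternaryGroupType")]
HB.structure Definition TernaryGroup :=
  {G of TernarySemigroup_isTernaryGroup G & TernarySemigroup G}.

Section Skew.
Variable G : ternaryGroupType.
Implicit Types a b x z : G.

Lemma termulI a b : injective (termul a b).
Proof.
have [x bt] := tsolve_l b b b.
have [c cx] := tsolve_l b a x.
suff K z : [t c b [t a b z]] = z by apply: (can_inj (g := termul c b)).
have [u <-] := tsolve_m b b z.
rewrite -(termulAr a) -(termulAl a) -(termulAr c) -(termulAl c).
by rewrite -termulAr -termulAl cx bt.
Qed.

Definition skew_elt x : G := sval (cid (tsolve_r x x x)).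

Lemma skew_eltP x : [t x x (skew_elt x)] = x.
Proof. by rewrite /skew_elt; case: cid. Qed.

Lemma skew_elt_uniq x z : [t x x z] = x -> z = skew_elt x.
Proof. by rewrite -{3}(skew_eltP x) => /termulI. Qed.

End Skew.

(* Alias of G, carrying the ternary group structure [t x y z] = x * y * z. *)
Definition der (G : groupType) : Type := G.

Section Derived.
Variable G : groupType.

Let dmul (x y z : der G) : der G := (x : G) * (y : G) * (z : G).

Let dmulAl x y z u v : dmul (dmul x y z) u v = dmul x (dmul y z u) v.
Proof. by rewrite /dmul !mulgA. Qed.

Let dmulAr x y z u v : dmul x (dmul y z u) v = dmul x y (dmul z u v).
Proof. by rewrite /dmul !mulgA. Qed.

HB.instance Definition _ := isTernarySemigroup.Build (der G)
  (inhabits (1 : G)) dmulAl dmulAr.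

Let dsolve_l (a b c : der G) : exists x : der G, [t x a b] = c.
Proof.
exists ((c : G) * (b : G)^-1 * (a : G)^-1).
by rewrite /termul /= /dmul mulgVK mulgVK.
Qed.

Let dsolve_m (a b c : der G) : exists y : der G, [t a y b] = c.
Proof.
exists ((a : G)^-1 * ((c : G) * (b : G)^-1)).
by rewrite /termul /= /dmul mulVKg mulgVK.
Qed.

Let dsolve_r (a b c : der G) : exists z : der G, [t a b z] = c.
Proof.
exists (((a : G) * (b : G))^-1 * (c : G)).
by rewrite /termul /= /dmul mulVKg.
Qed.

HB.instance Definition _ := TernarySemigroup_isTernaryGroup.Build (der G)
  dsolve_l dsolve_m dsolve_r.

End Derived.

(* The general linear group of a possibly infinite-dimensional vector space. *)
Record GL (K : fieldType) (V : lmodType K) := MkGL {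
  gl_fun :> {linear V -> V};
  gl_bij : bijective gl_fun
}.

Section GLGroup.
Variables (K : fieldType) (V : lmodType K).
Implicit Types f g h : GL V.

Lemma linear_funext (U W : lmodType K) (f g : {linear U -> W}) :
  f =1 g -> f = g.
Proof.
case: f g => [f [[fD] [fZ]]] [g [[gD] [gZ]]] /= /funext fg.
case: g / fg gD gZ => gD gZ.
by rewrite (Prop_irrelevance fD gD) (Prop_irrelevance fZ gZ).
Qed.

Lemma GL_funext f g : f =1 g -> f = g.
Proof.
case: f g => [f fb] [g gb] /= /linear_funext fg.
by case: g / fg gb => gb; congr MkGL; exact: Prop_irrelevance.
Qed.

HB.instance Definition _ := gen_eqMixin (GL V).
HB.instance Definition _ := gen_choiceMixin (GL V).

Definition GL_mul f g : GL V :=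
  @MkGL K V (f \o g : {linear V -> V}) (bij_comp (gl_bij f) (gl_bij g)).

Definition GL_one : GL V := @MkGL K V idfun (inv_bij (fun=> erefl)).

Fact GL_inv_subproof f : exists g : GL V, cancel g f /\ cancel f g.
Proof.
have [g fK gK] := gl_bij f.
pose gL := GRing.isLinear.Build K V V _ g (can2_linear fK gK).
pose gl : {linear V -> V} := HB.pack g gL.
by exists (@MkGL K V gl (Bijective gK fK)).
Qed.

Definition GL_inv f : GL V := sval (cid (GL_inv_subproof f)).

Fact GL_mulA : associative GL_mul.
Proof. by move=> f g h; apply: GL_funext. Qed.

Fact GL_mul1 : left_id GL_one GL_mul.
Proof. by move=> f; apply: GL_funext. Qed.

Fact GL_mulr1 : right_id GL_one GL_mul.
Proof. by move=> f; apply: GL_funext. Qed.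

Fact GL_mulV : left_inverse GL_one GL_inv GL_mul.
Proof.
by move=> f; apply: GL_funext => v /=; rewrite /GL_inv; case: cid => g [].
Qed.

Fact GL_mulrV : right_inverse GL_one GL_inv GL_mul.
Proof.
by move=> f; apply: GL_funext => v /=; rewrite /GL_inv; case: cid => g [].
Qed.

HB.instance Definition _ := isGroup.Build (GL V)
  GL_mulA GL_mul1 GL_mulr1 GL_mulV GL_mulrV.

End GLGroup.

Definition representation (G : groupType) (K : fieldType) (V : lmodType K) :=
  {multiplicative G -> GL V}.

Record left_representation (G : ternaryGroupType) (K : fieldType)
    (V : lmodType K) := LeftRepresentation {
  lrep :> G -> G -> {linear V -> V};
  lrepM : forall x1 x2 x3 x4 : G,
    lrep x1 x2 \o lrep x3 x4 = lrep [t x1 x2 x3] x4 :> (V -> V);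
  lrep_skew : forall x : G, lrep x (skew_elt x) = idfun :> (V -> V)
}.

(* Main.v *)
(* The correspondence sends rho to P x y = rho (x * y), with inverse           *)
(* rho x = P x 1: since skew elements in der G are inverses, P 1 1 = id, and   *)
(* composing with P 1 1 shows P x y = P (x * y) 1, i.e. P depends only on the  *)
(* product x * y.                                                              *)
From HB Require Import structures.
Require Import Defs.
From mathcomp Require Import all_boot all_algebra.
From mathcomp Require Import boolp.

Set Implicit Arguments.
Unset Strict Implicit.
Unset Printing Implicit Defensive.

Local Open Scope group_scope.

(** Multiplicativity of [rho] turns into the left representation law by regrouping a product of four
    elements. Conversely, [P x 1 \o P y 1 = P (x * y) 1], so [P x 1] is multiplicative in [x] and
    invertible. The two round trips reduce to [rho (x * 1) = rho x] and [P (x * y) 1 = P x y]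
    ([lrep_derE]). *)

Lemma skew_derE (G : groupType) (x : G) : skew_elt (x : der G) = x^-1.
Proof. by apply/esym/skew_elt_uniq; exact: mulgK. Qed.

(** The two axioms are propositions, so proof irrelevance leaves only the underlying maps to
    compare. *)
Lemma lrep_eq (G : ternaryGroupType) (K : fieldType) (V : lmodType K)
    (P Q : left_representation G V) : (forall x y, P x y =1 Q x y) -> P = Q.
Proof.
case: P Q => [p pM ps] [q qM qs] /= pq.
have {}pq : p = q by apply/funext => x; apply/funext => y; exact: linear_funext.
by case: q / pq qM qs => qM qs; congr LeftRepresentation; exact: Prop_irrelevance.
Qed.

Lemma multiplicative_eq (G H : groupType) (f g : {multiplicative G -> H}) :
  f =1 g -> f = g.
Proof.
case: f g => [f [[fM]]] [g [[gM]]] /= /funext fg.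
by case: g / fg gM => gM; rewrite (Prop_irrelevance fM gM).
Qed.

Section LeftRepresentationOfGroupRepresentation.
Variables (G : groupType) (K : fieldType) (V : lmodType K).
Variable rho : representation G V.

Let P (x y : der G) : {linear V -> V} := rho ((x : G) * (y : G)).

Let PM x1 x2 x3 x4 : P x1 x2 \o P x3 x4 = P [t x1 x2 x3] x4 :> (V -> V).
Proof.
rewrite /P [[t _ _ _]]/(((x1 : G) * (x2 : G)) * (x3 : G)) -mulgA.
by rewrite [in RHS]gmulfM.
Qed.

Let P_skew x : P x (skew_elt x) = idfun :> (V -> V).
Proof.
(* Preservation of the unit follows from multiplicativity by cancelling [rho 1] in the group
   [GL V]. *)
have rho1 : rho 1 = 1 by apply: (mulgI (rho 1)); rewrite -gmulfM !mulg1.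
by rewrite /P skew_derE mulgV rho1.
Qed.

Definition left_rep_of_rep := LeftRepresentation PM P_skew.

End LeftRepresentationOfGroupRepresentation.

Section GroupRepresentationOfLeftRepresentation.
Variables (G : groupType) (K : fieldType) (V : lmodType K).
Variable P : left_representation (der G) V.

Lemma lrep_der_comp (x1 x2 x3 x4 : G) v :
  P x1 x2 (P x3 x4 v) = P (x1 * x2 * x3) x4 v.
Proof. by have /(congr1 (@^~ v)) := lrepM P x1 x2 x3 x4. Qed.

Lemma lrep_der11 v : P (1 : G) (1 : G) v = v.
Proof.
have := lrep_skew P (1 : G); rewrite skew_derE invg1.
by move=> /(congr1 (@^~ v)).
Qed.

(** Inserting [P 1 1 = id] on the right moves [y] into the first argument. *)
Lemma lrep_derE (x y : G) : P x y =1 P (x * y) (1 : G).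
Proof. by move=> v; rewrite -{1}(lrep_der11 v) lrep_der_comp mulg1. Qed.

Let P1_bij (x : G) : bijective (P x (1 : G)).
Proof.
(* Both composites with [P x 1] collapse to [P 1 1], the identity. *)
by exists (P (x^-1) (1 : G)) => v;
  rewrite lrep_der_comp mulg1 ?mulVg ?mulgV lrep_der11.
Qed.

Let rho (x : G) : GL V := MkGL (P1_bij x).

Let rhoM : {morph rho : x y / x * y}.
Proof.
by move=> x y; apply: GL_funext => v; rewrite /= lrep_der_comp mulg1.
Qed.

HB.instance Definition _ := isMultiplicative.Build G (GL V) rho rhoM.

Definition rep_of_left_rep : representation G V := rho.

End GroupRepresentationOfLeftRepresentation.

Theorem proposition23 (G : groupType) (K : fieldType) (V : lmodType K) :
  exists f : representation G V -> left_representation (der G) V, bijective f.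
Proof.
exists (@left_rep_of_rep G K V); exists (@rep_of_left_rep G K V).
- move=> rho; apply: multiplicative_eq => x; apply: GL_funext => v /=.
  by rewrite mulg1.
- by move=> P; apply: lrep_eq => x y v /=; rewrite [RHS]lrep_derE.
Qed.
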